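(* Let $I=[-1,1]$ and let $f:I\to\mathbb{R}$ be bounded and measurable, and suppose $f$ does not agree almost everywhere on $I$ with the restriction to $I$ of a function in the Laguerre–Pólya class. Let $\{p_n\}$ be a sequence of real polynomials, each with only real zeros, with $\sup_n\sup_{x\in I}|p_n(x)|<\infty$, that converges weak-$\ast$ to $f$ in $L^\infty(I,dx)$. Then the sequence $\{p_n(x)\}$ diverges for almost every $x$ in the set $\{x\in I: f(x)\ne 0\}$.
   Context: The Laguerre–Pólya class is the collection of entire functions that are limits, uniformly on compact subsets of $\mathbb{C}$, of real polynomials with only real zeros. A sequence $p_n$ converges weak-$\ast$ to $f$ in $L^\infty(I,dx)$ if $\int_I p_n g\,dx\to\int_I f g\,dx$ for every Lebesgue integrable $g$ on $I$. *)

(* Defs.v *)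
From HB Require Import structures.
From mathcomp Require Import all_boot all_order all_algebra.
From mathcomp Require Import all_classical all_reals all_analysis.
From mathcomp Require Import complex.

Set Implicit Arguments.
Unset Strict Implicit.
Unset Printing Implicit Defensive.
Import Order.TTheory GRing.Theory Num.Theory.
Import numFieldNormedType.Exports.

Local Open Scope classical_set_scope.
Local Open Scope ring_scope.
Local Open Scope complex_scope.

(* The real line with the Lebesgue sigma-algebra, i.e. the Caratheodory
   completion of the Borel one; [measurableTypeR R] would only give Borel sets.
   It is convertible to [R]. *)
Definition lebesgueR (R : realType) : measurableType _ :=
  caratheodory_type (wlength (@idfun R))^*%mu.

(* Lebesgue measure on [lebesgueR R]. *)
Notation leb R := (@completed_lebesgue_measure R).

Definition complex_poly (R : realType) (p : {poly R}) : {poly R[i]} :=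
  map_poly (fun x : R => x%:C) p.

(* All zeros in the complex plane are real; in particular the zero polynomial,
   which vanishes at 'i, is excluded and the nonzero constants are included. *)
Definition only_real_zeros (R : realType) (p : {poly R}) : Prop :=
  forall z : R[i], root (complex_poly p) z -> complex.Im z = 0.

Definition entire (R : realType) (F : R[i] -> R[i]) : Prop :=
  forall z : R[i], derivable (F : R[i]^o -> R[i]^o) z 1.

Definition LaguerrePolya (R : realType) (F : R[i] -> R[i]) : Prop :=
  entire F /\
  exists q : nat -> {poly R},
    (forall n, only_real_zeros (q n)) /\
    {family compact, (fun n z => (complex_poly (q n)).[z]) @ \oo
      --> (F : R[i]^o -> R[i]^o)}.

(* Convergence of [u n] to [f] in the weak-* topology of L^oo(I, dx), as the
   dual of L^1(I, dx). *)
Definition weak_star_cvg (R : realType) (I : set R)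
    (u : nat -> R -> R) (f : R -> R) : Prop :=
  forall g : lebesgueR R -> R, (leb R).-integrable I (EFin \o g) ->
    (\int[leb R]_(x in I) (u n x * g x)) @[n --> \oo]
      --> \int[leb R]_(x in I) (f x * g x).

(* Main.v *)
(** Suppose that the [p n] converge to a nonzero limit on a non-null set. Then on
    some non-null Borel set [E] all late [p n] are nearly constant, with a common
    constant. Between two consecutive zeros the logarithmic derivative of a
    real-rooted polynomial drops too fast for the polynomial to be nearly constant
    on most of the gap. Hence near a density point of [E] the zeros of [p n]
    cluster in a short interval, and [p n] has no zero between four fixed points
    of [E], chosen among two quadruples. On such a zero-free interval the values
    at the four points bound the sums of [1 / (t - a)] and [1 / (t - a)^2] over
    the zeros [a], and [|1 + w| <= exp (Re w + |w|^2 / 2)] turns this into a bound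
    for [p n] on every disk of the complex plane. By Cauchy's estimates and a
    diagonal argument a subsequence converges locally uniformly to an entire
    function, which lies in the Laguerre-Polya class and, by the weak-* convergence,
    agrees with [f] almost everywhere. The same weak-* argument shows that [f]
    vanishes almost everywhere on the set where [p n] tends to zero. *)

Require Import Defs.
From mathcomp Require Import all_boot all_order all_algebra.
From mathcomp Require Import all_classical all_reals all_analysis.
From mathcomp Require Import complex measurable_realfun ring lra zify.
Set Implicit Arguments.
Unset Strict Implicit.
Unset Printing Implicit Defensive.
Import Order.TTheory GRing.Theory Num.Theory.
Import numFieldNormedType.Exports.
Local Open Scope classical_set_scope.
Local Open Scope ring_scope.
Local Open Scope complex_scope.

Import Normc.

(** * Real-rooted polynomials *)

Section RealRootedPolynomials.
Variable R : realType.
Implicit Types (s : seq R) (t u : R).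

Definition root_poly s : {poly R} := \prod_(a <- s) ('X - a%:P).

(** The logarithmic derivative of [root_poly s] at [t]. *)
Definition sum_inv s t : R := \sum_(a <- s) (t - a)^-1.

(** Factor over the complex numbers; each zero is real, hence equal to its real part. The zero
    polynomial is excluded because it vanishes at ['i]. *)
Lemma real_rooted_split (p : {poly R}) :
  only_real_zeros p -> exists c s, c != 0 /\ p = c *: root_poly s.
Proof.
move=> hp; have [z Ez] := closed_field_poly_normal (complex_poly p).
have p0 : p != 0.
  apply/eqP => p0; have := hp 'i%C.
  by rewrite p0 /complex_poly map_poly0 root0 => /(_ isT)/eqP/=; rewrite oner_eq0.
have q0 : lead_coef (complex_poly p) != 0.
  by rewrite lead_coef_eq0 map_poly_eq0.
exists (lead_coef p), (map (@complex.Re R) z); split; first by rewrite lead_coef_eq0.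
apply: (map_poly_inj (real_complex R)).
rewrite -[LHS]/(complex_poly p) Ez linearZ/= lead_coef_map; congr (_ *: _).
rewrite /root_poly big_map rmorph_prod/=; apply: eq_big_seq => x xz.
rewrite rmorphB/= map_polyX map_polyC/=; congr ('X - _%:P).
have : root (complex_poly p) x.
  by rewrite Ez rootZ// root_prod_XsubC.
by move=> /hp; case: x xz => a b /= _ ->.
Qed.

Lemma horner_root_poly s t : (root_poly s).[t] = \prod_(a <- s) (t - a).
Proof.
by rewrite horner_prod; apply: eq_bigr => a _; rewrite hornerXsubC.
Qed.

(** Each zero contributes the factor [1 + (u - t) / (t - a)], which is positive by hypothesis and at
    most the exponential of [(u - t) / (t - a)]. *)
Lemma root_poly_ratio s t u : {in s, forall a, 0 < (t - a) * (u - a)} ->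
  0 < (root_poly s).[u] / (root_poly s).[t]
    <= expR ((u - t) * sum_inv s t).
Proof.
rewrite !horner_root_poly /sum_inv; elim: s => [|a s IH] h.
  by rewrite !big_nil mulr0 expR0 divr1 ltr01 lexx.
rewrite !big_cons.
have /h ha : a \in a :: s by rewrite mem_head.
have {}IH := IH (fun b bs => h b (mem_behead (s := a :: s) bs)).
have ta : t - a != 0 by apply: contraTneq ha => ->; rewrite mul0r ltxx.
rewrite mulrDr expRD.
have -> : forall A B C D : R, (A * B) / (C * D) = (A / C) * (B / D).
  by move=> A B C D; rewrite invfM mulrACA.
have r0 : 0 < (u - a) / (t - a).
  by rewrite -(divfK ta (u - a)) mulrCA -expr2 pmulr_lgt0 ?exprn_even_gt0// in ha.
have r1 : (u - a) / (t - a) <= expR ((u - t) / (t - a)).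
  apply: le_trans (expR_ge1Dx _); rewrite le_eqVlt; apply/orP; left.
  by apply/eqP; field.
case/andP: IH => IH1 IH2.
by rewrite mulr_gt0//= ler_pM// ltW.
Qed.

(** By [root_poly_ratio] the quotient of the values is at least [expR ((t - u) * sum_inv s t)],
    hence at least [1 + (t - u) * sum_inv s t]. Nearly equal values thus bound the logarithmic
    derivative from one side. *)
Lemma slope_sum_inv s t u e : {in s, forall a, 0 < (t - a) * (u - a)} ->
  (root_poly s).[t] / (root_poly s).[u] <= 1 + e ->
  (t - u) * sum_inv s t <= e.
Proof.
move=> /root_poly_ratio/andP[h1 h2] h3.
rewrite -(lerD2l 1); apply: le_trans h3; apply: le_trans (expR_ge1Dx _) _.
rewrite -[leRHS]invf_div -[leLHS]invrK lef_pV2 ?posrE ?invr_gt0 ?expR_gt0//.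
by rewrite -expRN -mulNr opprB.
Qed.

Lemma sum_invB s t u : {in s, forall a, 0 < (t - a) * (u - a)} ->
  sum_inv s t - sum_inv s u = (u - t) * \sum_(a <- s) ((t - a) * (u - a))^-1.
Proof.
move=> h; rewrite /sum_inv -sumrB mulr_sumr; apply: eq_big_seq => a /h ha.
have := lt0r_neq0 ha; rewrite mulf_eq0 => /norP[h1 h2]; field.
by rewrite h1 h2.
Qed.

Lemma root_free_pos s x y t u : {in s, forall a, ~~ (x <= a <= y)} ->
  x <= t <= y -> x <= u <= y -> {in s, forall a, 0 < (t - a) * (u - a)}.
Proof.
move=> h /andP[h1 h2] /andP[h3 h4] a /h; rewrite negb_and -!ltNge => /orP[ax|ya].
  by rewrite mulr_gt0// subr_gt0; apply: lt_le_trans ax _.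
by rewrite nmulr_rgt0 subr_lt0; apply: le_lt_trans ya.
Qed.

(* The logarithmic derivative drops by at least the contribution of the zero
   [a], whereas the almost constant values keep it small. *)
Lemma gap_not_flat s a l t1 t2 t3 t4 : a \in s -> a < t1 -> 0 < l ->
  l <= t2 - t1 -> l <= t3 - t2 -> l <= t4 - t3 -> t4 - a <= 7 * l ->
  {in s, forall b, ~~ (t1 <= b <= t4)} ->
  (root_poly s).[t2] / (root_poly s).[t1] <= 1 + 1 / 100 ->
  (root_poly s).[t3] / (root_poly s).[t4] <= 1 + 1 / 100 ->
  False.
Proof.
move=> sa at1 l0 l12 l23 l34 la hs h2 h3.
have P := root_free_pos hs.
have {}h2 := slope_sum_inv (P t2 t1 ltac:(apply/andP; split; lra)
                                   ltac:(apply/andP; split; lra)) h2.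
have {}h3 := slope_sum_inv (P t3 t4 ltac:(apply/andP; split; lra)
                                   ltac:(apply/andP; split; lra)) h3.
have {}P := P t2 t3 ltac:(apply/andP; split; lra) ltac:(apply/andP; split; lra).
have D := sum_invB P.
have : ((t2 - a) * (t3 - a))^-1 <= \sum_(b <- s) ((t2 - b) * (t3 - b))^-1.
  rewrite (big_rem a)//= lerDl big_seq sumr_ge0// => b /mem_rem bs.
  by rewrite invr_ge0 ltW// P.
set S := \sum_(b <- s) _ in D * => hS.
have pa := P a sa.
(* Both [t2 - a] and [t3 - a] lie between 0 and [7 * l]. *)
have q : (7 * l) ^- 2 <= S.
  apply: le_trans hS; rewrite lef_pV2 ?posrE ?exprn_gt0//; last by lra.
  rewrite expr2; apply: ler_pM; lra.
have i0 : 0 < l^-1 by rewrite invr_gt0.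
have E : (7 * l) ^- 2 = l^-1 * l^-1 / 49 by field; lra.
have ll : l * l^-1 = 1 by rewrite divff ?gt_eqF.
rewrite E in q.
have q1 : l * (l^-1 * l^-1 / 49) <= (t3 - t2) * S.
  apply: ler_pM => //; first by rewrite ltW.
  by rewrite !mulr_ge0// ltW.
(* From [t2] to [t3] the logarithmic derivative drops by at least [l^-1 / 49], while the values
   allow a drop of at most twice [l^-1 / 100]. *)
have q2 : sum_inv s t2 <= l^-1 / 100.
  rewrite leNgt; apply/negP => H.
  suff : l * (l^-1 / 100) < (t2 - t1) * sum_inv s t2 by nra.
  apply: (@le_lt_trans _ _ ((t2 - t1) * (l^-1 / 100))).
    by rewrite ler_wpM2r// divr_ge0// ltW.
  by rewrite ltr_pM2l//; lra.
have q3 : - sum_inv s t3 <= l^-1 / 100.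
  rewrite leNgt; apply/negP => H.
  suff : l * (l^-1 / 100) < (t4 - t3) * - sum_inv s t3 by nra.
  apply: (@le_lt_trans _ _ ((t4 - t3) * (l^-1 / 100))).
    by rewrite ler_wpM2r// divr_ge0// ltW.
  by rewrite ltr_pM2l//; lra.
have : l * (l^-1 * l^-1 / 49) = l^-1 / 49 by rewrite !mulrA ll mul1r.
nra.
Qed.

(** The values bound [sum_inv] above at [t2] and below at [t3]. Its decrease in between is [t3 - t2]
    times a sum of positive terms, so that sum and [sum_inv s t2] are both bounded independently of
    [s]. *)
Lemma sum_inv_bounded t1 t2 t3 t4 : t1 < t2 -> t2 < t3 -> t3 < t4 ->
  exists C : R, forall s, {in s, forall b, ~~ (t1 <= b <= t4)} ->
  (root_poly s).[t2] / (root_poly s).[t1] <= 1 + 1 / 100 ->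
  (root_poly s).[t3] / (root_poly s).[t4] <= 1 + 1 / 100 ->
  `|sum_inv s t2| <= C /\ \sum_(a <- s) (t2 - a) ^- 2 <= C.
Proof.
move=> t12 t23 t34.
pose C0 := (t2 - t1)^-1 + (t4 - t3)^-1.
(* [K] bounds [(t3 - a) / (t2 - a)] for [a] outside [[t1, t4]]: this quotient increases to [K] as
   [a] tends to [t1] from the left, and is below 1 to the right of [t4]. *)
pose K := 1 + (t3 - t2) / (t2 - t1).
have i1 : 0 < (t2 - t1)^-1 by rewrite invr_gt0 subr_gt0.
have i2 : 0 < (t4 - t3)^-1 by rewrite invr_gt0 subr_gt0.
have i3 : 0 < (t3 - t2)^-1 by rewrite invr_gt0 subr_gt0.
have C00 : 0 < C0 by rewrite addr_gt0.
have K1 : 1 <= K by rewrite lerDl mulr_ge0 ?ltW// subr_gt0.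
exists (C0 + K * (C0 * (t3 - t2)^-1)) => s hs h2 h3.
have P := root_free_pos hs.
have {}h2 := slope_sum_inv (P t2 t1 ltac:(apply/andP; split; lra)
                                   ltac:(apply/andP; split; lra)) h2.
have {}h3 := slope_sum_inv (P t3 t4 ltac:(apply/andP; split; lra)
                                   ltac:(apply/andP; split; lra)) h3.
have {}P := P t2 t3 ltac:(apply/andP; split; lra) ltac:(apply/andP; split; lra).
have D := sum_invB P.
have S0 : 0 <= \sum_(a <- s) ((t2 - a) * (t3 - a))^-1.
  by rewrite big_seq sumr_ge0// => b /P; rewrite -invr_gt0 => /ltW.
set S := \sum_(b <- s) _ in D S0.
have q2 : sum_inv s t2 <= (t2 - t1)^-1.
  rewrite -[leRHS]mul1r ler_pdivlMr ?subr_gt0// mulrC; lra.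
have q3 : - (t4 - t3)^-1 <= sum_inv s t3.
  rewrite lerNl -[leRHS]mul1r ler_pdivlMr ?subr_gt0// mulrC mulrN -mulNr opprB; lra.
have S1 : S <= C0 / (t3 - t2) by rewrite ler_pdivlMr ?subr_gt0// mulrC -D /C0; lra.
have D0 : 0 <= (t3 - t2) * S by rewrite mulr_ge0// subr_ge0 ltW.
have KC : 0 <= K * (C0 * (t3 - t2)^-1).
  by rewrite !mulr_ge0 ?ltW//; lra.
split; first by rewrite ler_norml; apply/andP; split; rewrite /C0 in KC *; lra.
apply: (@le_trans _ _ (K * S)); last first.
  have : K * S <= K * (C0 * (t3 - t2)^-1) by rewrite ler_wpM2l//; lra.
  by move=> H; lra.
rewrite mulr_sumr big_seq [leRHS]big_seq ler_sum// => a sa.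
have pa := P a sa; have hsa := hs a sa.
have n2 : t2 - a != 0 by apply: contraTneq pa => ->; rewrite mul0r ltxx.
have n3 : t3 - a != 0 by apply: contraTneq pa => ->; rewrite mulr0 ltxx.
have p2 : 0 < (t2 - a) ^+ 2 by rewrite exprn_even_gt0.
rewrite -[leLHS]mul1r ler_pdivrMr// mulrAC ler_pdivlMr// mul1r.
have -> : K = (t3 - t1) / (t2 - t1) by rewrite /K; field; lra.
rewrite mulrAC ler_pdivlMr; last by lra.
move: hsa; rewrite negb_and -!ltNge => /orP[at1|at4]; rewrite expr2.
  have -> : (t3 - t1) * ((t2 - a) * (t2 - a)) = (t2 - a) * ((t3 - t1) * (t2 - a)) by ring.
  rewrite -mulrA ler_wpM2l//; first by lra.
  by nra.
have -> : (t3 - t1) * ((t2 - a) * (t2 - a)) =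
          (a - t2) * ((t3 - t1) * (a - t2)) by ring.
have -> : (t2 - a) * (t3 - a) * (t2 - t1) =
          (a - t2) * ((a - t3) * (t2 - t1)) by ring.
rewrite ler_wpM2l//; first by lra.
by nra.
Qed.

End RealRootedPolynomials.

(** * Bounds in the complex plane *)

Section ComplexBounds.
Variable R : realType.
Implicit Types (s : seq R) (t u : R) (z w : R[i]) (p : {poly R}).

Lemma normc_real (x : R) : normc x%:C = `|x|.
Proof. by rewrite /normc/= expr0n/= addr0 sqrtr_sqr. Qed.

Lemma normcX z n : normc (z ^+ n) = normc z ^+ n.
Proof. by elim: n => [|n IH]; rewrite ?normc1// !exprS normcM IH. Qed.

Lemma normc_ge0 z : 0 <= normc z.
Proof. by case: z => a b; rewrite sqrtr_ge0. Qed.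

Lemma normc_sum (I : Type) (r : seq I) (P : pred I) (F : I -> R[i]) :
  normc (\sum_(i <- r | P i) F i) <= \sum_(i <- r | P i) normc (F i).
Proof.
elim/big_ind2: _ => //; first by rewrite normc0.
by move=> x y u v h1 h2; apply: le_trans (le_normcD _ _) (lerD h1 h2).
Qed.

Lemma normc_le_ReIm z : normc z <= `|complex.Re z| + `|complex.Im z|.
Proof.
case: z => a b /=; rewrite -(@ler_pXn2r _ 2) ?nnegrE ?sqrtr_ge0 ?addr_ge0//.
rewrite sqr_sqrtr ?addr_ge0 ?sqr_ge0// sqrrD !real_normK ?num_real//.
by rewrite addrAC lerDl mulrn_wge0// mulr_ge0.
Qed.

Lemma Re_le_normc z : `|complex.Re z| <= normc z.
Proof.
by case: z => a b /=; rewrite -sqrtr_sqr ler_wsqrtr// lerDl sqr_ge0.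
Qed.

Lemma Im_le_normc z : `|complex.Im z| <= normc z.
Proof.
by case: z => a b /=; rewrite -sqrtr_sqr ler_wsqrtr// lerDr sqr_ge0.
Qed.

Lemma normc_complex_poly_le p z : normc (complex_poly p).[z] <=
  \sum_(k < size p) `|p`_k| * normc z ^+ k.
Proof.
rewrite horner_coef size_map_poly; apply: le_trans (normc_sum _ _ _) _.
by apply: ler_sum => k _; rewrite coef_map normcM normc_real normcX.
Qed.

Lemma horner_complex_root_poly s z :
  (complex_poly (root_poly s)).[z] = \prod_(a <- s) (z - a%:C).
Proof.
rewrite /complex_poly /root_poly rmorph_prod/= horner_prod.
by apply: eq_bigr => a _; rewrite rmorphB/= map_polyX map_polyC/= hornerXsubC.
Qed.

(* From [|1 + w|^2 = 1 + 2 Re w + |w|^2 <= expR (2 Re w + |w|^2)] with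
   [w = (z - t) / (t - a)]. *)
Lemma normc_subC_le (a t : R) z : t != a ->
  normc (z - a%:C) <= `|t - a| *
    expR ((complex.Re z - t) * (t - a)^-1 + normc (z - t%:C) ^+ 2 / 2 * (t - a) ^- 2).
Proof.
case: z => x y ta; have d0 : t - a != 0 by rewrite subr_eq0.
rewrite -(@ler_pXn2r _ 2) ?nnegrE ?sqrtr_ge0 ?mulr_ge0 ?expR_ge0//.
rewrite /= !subr0 !sqr_sqrtr ?addr_ge0 ?sqr_ge0// exprMn -expRM_natl.
rewrite real_normK ?num_real//.
set E := expR _; have hE := expR_ge1Dx (2%:R *
  ((x - t) / (t - a) + ((x - t) ^+ 2 + y ^+ 2) / 2 / (t - a) ^+ 2)).
apply: le_trans (ler_wpM2l (sqr_ge0 _) hE).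
rewrite le_eqVlt; apply/orP; left; apply/eqP; field.
by rewrite d0.
Qed.

Lemma normc_root_poly_le s t z : t \notin s ->
  normc (complex_poly (root_poly s)).[z] <= `|(root_poly s).[t]| *
    expR ((complex.Re z - t) * sum_inv s t +
          normc (z - t%:C) ^+ 2 / 2 * \sum_(a <- s) (t - a) ^- 2).
Proof.
rewrite horner_complex_root_poly horner_root_poly /sum_inv.
elim: s => [_|a s IH]; first by rewrite !big_nil normc1 normr1 !mulr0 addr0 expR0 mul1r.
rewrite inE negb_or => /andP[ta /IH {}IH].
rewrite !big_cons normcM normrM !mulrDr addrACA expRD mulrACA.
by apply: ler_pM (normc_subC_le _ ta) IH; exact: normc_ge0.
Qed.

(** The bound involves neither the degree nor the zeros, so it is uniform over a family of
    polynomials sharing [t], [A] and [C]. *)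
Lemma normc_split_poly_le s (c t A C r : R) z : t \notin s ->
  `|(c *: root_poly s).[t]| <= A -> `|sum_inv s t| <= C ->
  \sum_(a <- s) (t - a) ^- 2 <= C -> normc z <= r ->
  normc (complex_poly (c *: root_poly s)).[z] <=
    A * expR ((r + `|t|) * C + (r + `|t|) ^+ 2 / 2 * C).
Proof.
move=> ts hA h1 h2 zr.
have C0 : 0 <= C by apply: le_trans h1.
have D : normc (z - t%:C) <= r + `|t|.
  apply: le_trans (le_normcD _ _) _; rewrite lerD//.
  by rewrite -(normc_real t) -(normcN t%:C).
have D1 : `|complex.Re z - t| <= r + `|t|.
  apply: le_trans D; have := Re_le_normc (z - t%:C).
  by case: (z).
have r0 : 0 <= r + `|t| by apply: le_trans D1.
rewrite /complex_poly linearZ/= hornerZ normcM normc_real.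
rewrite hornerZ normrM in hA.
apply: le_trans (ler_wpM2l (normr_ge0 c) (normc_root_poly_le z ts)) _.
rewrite mulrA; apply: ler_pM => //; rewrite ?expR_ge0 ?mulr_ge0// ler_expR.
apply: lerD.
  by apply: le_trans (ler_norm _) _; rewrite normrM ler_pM.
apply: ler_pM => //; first by rewrite mulr_ge0 ?sqr_ge0.
  by rewrite sumr_ge0// => a _; rewrite invr_ge0 sqr_ge0.
by rewrite ler_wpM2r// ler_pXn2r ?nnegrE ?normc_ge0.
Qed.

(* Cauchy's estimate, by halving the degree: the even and odd parts [E], [O] of
   [q] satisfy [2 E(z^2) = q(z) + q(-z)] and [2 z O(z^2) = q(z) - q(-z)]. *)
Lemma coef_le_circle (q : {poly R[i]}) (r B : R) : 0 < r ->
  (forall z, normc z = r -> normc q.[z] <= B) ->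
  forall k, normc q`_k * r ^+ k <= B.
Proof.
have [n] := ubnP (size q); elim: n => // n IH in q r B *.
rewrite ltnS => szq r0 h k.
have B0 : 0 <= B.
  by apply: le_trans (h r%:C _); rewrite ?normc_ge0// normc_real gtr0_norm.
have [sz1|sz1] := leqP (size q) 1.
  have [k0|k0] := posnP k.
    have := h r%:C; rewrite normc_real gtr0_norm// (size1_polyC sz1) hornerC coefC.
    by rewrite k0 eqxx expr0 mulr1; apply.
  by rewrite nth_default ?normc0 ?mul0r// (leq_trans sz1).
have n2 : normc 2 = 2 :> R.
  by rewrite -(rmorph_nat (real_complex R) 2) normc_real ger0_norm.
have qN z : normc z = r -> normc q.[- z] <= B by move=> zr; apply: h; rewrite normcN.
have E z : q.[z] = (even_poly q).[z ^+ 2] + (odd_poly q).[z ^+ 2] * z.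
  rewrite -[in LHS](poly_even_odd q) hornerD hornerM !horner_comp hornerXn hornerX.
  by [].
(* Squaring maps the circle of radius [r] onto that of radius [r ^+ 2], so bounds for [q] on the
   first give bounds for its even and odd parts on the second. *)
have sqrt_r z : normc z = r ^+ 2 -> exists2 w, z = w ^+ 2 & normc w = r.
  move=> zr; exists (sqrtc z); first by rewrite sqr_sqrtc.
  apply/eqP; rewrite -(@eqrXn2 _ 2) ?normc_ge0 ?(ltW r0)//.
  by rewrite -normcX sqr_sqrtc zr.
have r20 : 0 < r ^+ 2 by rewrite exprn_gt0.
have he z : normc z = r ^+ 2 -> normc (even_poly q).[z] <= B.
  move=> /sqrt_r[w -> wr].
  rewrite -(@ler_pM2l _ 2)// -[in leLHS]n2 -normcM.
  have -> : 2 * (even_poly q).[w ^+ 2] = q.[w] + q.[- w].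
    by rewrite !E sqrrN; ring.
  by apply: le_trans (le_normcD _ _) _; have := lerD (h w wr) (qN w wr); lra.
have ho z : normc z = r ^+ 2 -> normc (odd_poly q).[z] <= B / r.
  move=> /sqrt_r[w -> wr].
  rewrite ler_pdivlMr// -wr -normcM -(@ler_pM2l _ 2)// -[in leLHS]n2 -normcM.
  have -> : 2 * ((odd_poly q).[w ^+ 2] * w) = q.[w] + - q.[- w].
    by rewrite !E sqrrN; ring.
  apply: le_trans (le_normcD _ _) _; rewrite normcN.
  by have := lerD (h w wr) (qN w wr); lra.
have sE : (size (even_poly q) < n)%N.
  apply: leq_ltn_trans (size_even_poly _) _; apply: leq_trans szq.
  by rewrite uphalf_half; lia.
have sO : (size (odd_poly q) < n)%N.
  apply: leq_ltn_trans (size_odd_poly _) _; apply: leq_trans szq.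
  by lia.
rewrite -(odd_double_half k); case: (odd k) => /=.
  have := IH _ _ _ sO r20 ho k./2; rewrite coef_odd_poly add1n -exprM mul2n exprS.
  by rewrite ler_pdivlMr// mulrCA mulrC.
have := IH _ _ _ sE r20 he k./2; rewrite coef_even_poly add0n -exprM mul2n.
by [].
Qed.

End ComplexBounds.

(** * Locally uniform limits of polynomials *)

Section PowerSeriesLimits.
Variable R : realType.
Implicit Types (z w h : R[i]).

(** Coefficient form of uniform boundedness on every disk. *)
Definition super_bounded (q : nat -> {poly R}) : Prop :=
  forall r : R, 0 < r -> exists B, forall n k, `|(q n)`_k| * r ^+ k <= B.

(** With the exact geometric partial sum on the right, the induction step is an identity. *)
Lemma sum_geometric_tail (u : nat -> R) (B : R) (K j : nat) :
  (forall k, u k * 2 ^+ k <= B) ->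
  \sum_(K <= k < K + j) u k <= B * 2 * (2 ^- K - 2 ^- (K + j)).
Proof.
move=> h; elim: j => [|j IH]; first by rewrite addn0 big_geq// subrr mulr0.
rewrite addnS big_nat_recr ?leq_addr//=.
have := h (K + j)%N; rewrite -ler_pdivlMr ?exprn_gt0// => h1.
apply: le_trans (lerD IH h1) _; rewrite exprS invfM -subr_ge0.
set x := 2 ^- K; set y := 2 ^- (K + j).
by rewrite le_eqVlt; apply/orP; left; apply/eqP; field.
Qed.

Lemma sum_geometric_tail_le (u : nat -> R) (B : R) (K M : nat) :
  (forall k, 0 <= u k) -> (forall k, u k * 2 ^+ k <= B) ->
  \sum_(K <= k < M) u k <= B * 2 * 2 ^- K.
Proof.
move=> u0 h; have B0 : 0 <= B.
  by apply: le_trans (h 0%N); rewrite expr0 mulr1.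
have [MK|KM] := leqP M K.
  by rewrite big_geq// !mulr_ge0// invr_ge0 exprn_ge0.
rewrite -(subnKC (ltnW KM)); apply: le_trans (sum_geometric_tail _ _ h) _.
by rewrite ler_wpM2l ?mulr_ge0// lerBlDr lerDl invr_ge0 exprn_ge0.
Qed.

Lemma normc_complex_poly_leN (p : {poly R}) z (r : R) N : normc z <= r ->
  (size p <= N)%N -> normc (complex_poly p).[z] <= \sum_(0 <= k < N) `|p`_k| * r ^+ k.
Proof.
move=> zr pN; apply: le_trans (normc_complex_poly_le _ _) _.
rewrite -(big_mkord xpredT (fun k => `|p`_k| * normc z ^+ k)).
rewrite (big_cat_nat (leq0n _) pN)/= -[leLHS]addr0 lerD//.
  apply: ler_sum => k _; rewrite ler_wpM2l// lerXn2r// nnegrE ?normc_ge0//.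
  exact: le_trans (normc_ge0 z) zr.
rewrite sumr_ge0// => k _; rewrite mulr_ge0// exprn_ge0//.
exact: le_trans (normc_ge0 z) zr.
Qed.

(** Cut the power series at some [K]: the tails are uniformly small, and the heads consist of
    finitely many convergent coefficients. *)
Lemma cauchy_coefs_uniform (q : nat -> {poly R}) : super_bounded q ->
  (forall k, cvgn (fun n => (q n)`_k)) ->
  forall r e : R, 0 < r -> 0 < e -> exists N, forall n m z, (N <= n)%N -> (N <= m)%N ->
    normc z <= r -> normc ((complex_poly (q n)).[z] - (complex_poly (q m)).[z]) <= e.
Proof.
move=> sb cv r e r0 e0.
(* Boundedness at the doubled radius gives the terms at radius [r] a factor [2 ^- k]. *)
have [B hB] := sb (2 * r) (mulr_gt0 (ltr0n _ 2) r0).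
have B0 : 0 <= B.
  by apply: le_trans (hB 0 0); rewrite mulr_ge0// exprn_ge0// mulr_ge0// ltW.
have [K hK] : exists K : nat, 2 * B * 2 * 2 ^- K <= e / 2.
  have : (2 * B * 2) * (2^-1 ^+ n) @[n --> \oo] --> (2 * B * 2) * (0 : R).
    by apply: cvgMr; apply: cvg_expr; rewrite ger0_norm// invf_lt1// ltr1n.
  rewrite mulr0 => /cvgrPdist_le/(_ (e / 2))/(_ ltac:(by rewrite divr_gt0)).
  move=> [K _ /(_ K (leqnn K))].
  rewrite sub0r normrN => /= hK; exists K; rewrite -exprVn.
  exact: le_trans (ler_norm _) hK.
have S0 : (\sum_(0 <= k < K) `|lim ((q n)`_k @[n --> \oo]) - (q n)`_k| * r ^+ k)
    @[n --> \oo] --> \sum_(0 <= k < K) (`|(0:R)| * r ^+ k).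
  apply: cvg_big => [|k _]; first exact: add_continuous.
  apply: cvgMl; apply: cvg_norm; rewrite -[X in _ --> X](subrr (lim ((q n)`_k @[n --> \oo]))).
  by apply: cvgB; [exact: cvg_cst|exact: cv].
rewrite big1 in S0; last by move=> k _; rewrite normr0 mul0r.
move/cvgrPdist_le: S0 => /(_ (e / 4)) /(_ ltac:(by rewrite divr_gt0))[N _ hN].
exists N => n m z Nn Nm zr.
pose M := maxn (size (q n)) (size (q m)).
have -> : (complex_poly (q n)).[z] - (complex_poly (q m)).[z] =
    (complex_poly (q n - q m)).[z].
  by rewrite /complex_poly rmorphB/= hornerD hornerN.
(* The range is padded to [K + M] so that it can be cut at [K] whatever the degrees. *)
have szM : (size (q n - q m)%R <= K + M)%N.
  apply: leq_trans (leq_addl _ _); apply: leq_trans (size_polyD _ _) _.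
  by rewrite size_polyN.
apply: le_trans (normc_complex_poly_leN zr szM) _.
rewrite (big_cat_nat (leq0n _) (leq_addr M K))/=.
rewrite (_ : e = e / 4 + e / 4 + e / 2); last by field.
apply: lerD; last first.
  apply: le_trans hK; apply: sum_geometric_tail_le => k.
    by rewrite mulr_ge0// exprn_ge0// ltW.
  rewrite -mulrA -exprMn [r * 2]mulrC coefB.
  have H := lerD (hB n k) (hB m k); rewrite -mulrDl in H.
  rewrite (_ : 2 * B = B + B); last by ring.
  by apply: le_trans H; rewrite ler_wpM2r ?ler_normB// exprn_ge0// mulr_ge0// ltW.
have /= := hN n Nn; have /= := hN m Nm.
rewrite !sub0r !normrN => h1 h2.
apply: le_trans (lerD (le_trans (ler_norm _) h2) (le_trans (ler_norm _) h1)).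
rewrite -big_split/=; apply: ler_sum => k _.
rewrite -mulrDl ler_wpM2r ?exprn_ge0 ?(ltW r0)// coefB.
set l := lim _.
have -> : (q n)`_k - (q m)`_k = (l - (q m)`_k) - (l - (q n)`_k) by ring.
by rewrite [leRHS]addrC; exact: ler_normB.
Qed.

Lemma cvg_complex_poly (q : nat -> {poly R}) : super_bounded q ->
  (forall k, cvgn (fun n => (q n)`_k)) ->
  exists F : R[i] -> R[i], forall r e : R, 0 < r -> 0 < e ->
    exists N, forall n z, (N <= n)%N -> normc z <= r ->
      normc (F z - (complex_poly (q n)).[z]) <= e.
Proof.
move=> sb cv; have hC := cauchy_coefs_uniform sb cv.
(* [g] stands for the real or the imaginary part, so that completeness is applied in [R]. *)
have cvg_part (g : R[i] -> R) : (forall z w, g (z - w) = g z - g w) ->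
    (forall z, `|g z| <= normc z) ->
    forall z, cvgn (fun n => g (complex_poly (q n)).[z]).
  move=> gB gle z; apply: cauchy_cvg; apply: cauchy_exP => e e0.
  have z1 : 0 < normc z + 1 by rewrite ltr_wpDl ?normc_ge0.
  have [N hN] := hC _ _ z1 (ltac:(by rewrite divr_gt0) : 0 < e / 2).
  exists (g (complex_poly (q N)).[z]); exists N => // n /= Nn.
  rewrite /ball/= -gB; apply: le_lt_trans (gle _) _.
  apply: le_lt_trans (hN N n z _ _ _) _ => //; first by rewrite lerDl.
  by rewrite ltr_pdivrMr// mulr_natr mulr2n ltrDl.
pose F z := (lim ((complex.Re (complex_poly (q n)).[z]) @[n --> \oo])) +i*
            (lim ((complex.Im (complex_poly (q n)).[z]) @[n --> \oo])).
exists F => r e r0 e0.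
have e20 : 0 < e / 2 by rewrite divr_gt0.
have [N hN] := hC r (e / 2) r0 e20; exists N => n z Nn zr.
have part (g : R[i] -> R) : (forall z w, g (z - w) = g z - g w) ->
    (forall z, `|g z| <= normc z) ->
    g (F z) = lim (g (complex_poly (q n)).[z] @[n --> \oo]) ->
    `|g (F z - (complex_poly (q n)).[z])| <= e / 2.
  move=> gB gle gF; rewrite gB gF.
  have cl : `|g (complex_poly (q m)).[z] - g (complex_poly (q n)).[z]| @[m --> \oo]
    --> `|lim (g (complex_poly (q m)).[z] @[m --> \oo]) - g (complex_poly (q n)).[z]|.
    by apply: cvg_norm; apply: cvgB; [exact: cvg_part|exact: cvg_cst].
  apply: (closed_cvg (fun x : R => x <= e / 2)) cl; first exact: closed_le.
  exists N => // m /= Nm; rewrite -gB; apply: le_trans (gle _) _.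
  exact: hN.
apply: le_trans (normc_le_ReIm _) _; rewrite [leRHS](splitr e).
apply: lerD; apply: part => //.
- by move=> [a b] [c d].
- exact: Re_le_normc.
- by move=> [a b] [c d].
- exact: Im_le_normc.
Qed.

(** The factor [k.+1] is at most [2 ^+ k.+1] and is absorbed by doubling the radius. *)
Lemma super_bounded_deriv (q : nat -> {poly R}) :
  super_bounded q -> super_bounded (fun n => (q n)^`()).
Proof.
move=> sb r r0; have [B hB] := sb (2 * r) (mulr_gt0 (ltr0n _ 2) r0).
exists (B / r) => n k; rewrite coef_deriv ler_pdivlMr//.
apply: le_trans (hB n k.+1); rewrite normrMn -mulrA -exprSr exprMn mulrA.
rewrite ler_wpM2r ?exprn_ge0 ?(ltW r0)// -[leLHS]mulr_natr ler_wpM2l//.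
by rewrite -natrX ler_nat ltnW// ltn_expl.
Qed.

(** Induction: the next remainder is [z + h] times the present one plus [h ^+ 2 * z ^+ k *+ k.+1],
    and each summand is at most half of the new bound. *)
Lemma normc_pow_taylor2 z h k : normc h <= 1 ->
  normc ((z + h) ^+ k.+1 - z ^+ k.+1 - h * z ^+ k *+ k.+1) <=
    normc h ^+ 2 * (2 * (normc z + 1)) ^+ k.+1.
Proof.
move=> h1; have z1 : 1 <= normc z + 1 by rewrite lerDr normc_ge0.
have z0 := normc_ge0 z; have h0 := normc_ge0 h.
elim: k => [|k IH].
  have -> : (z + h) ^+ 1 - z ^+ 1 - h * z ^+ 0 *+ 1 = 0 by ring.
  by rewrite normc0 mulr_ge0 ?sqr_ge0//; lra.
set D := _ - _ in IH.
have -> : (z + h) ^+ k.+2 - z ^+ k.+2 - h * z ^+ k.+1 *+ k.+2 =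
  (z + h) * D + h ^+ 2 * z ^+ k *+ k.+1.
  rewrite /D !(exprS _ k.+1) (exprS z k) (mulrS (h * _) k.+1).
  rewrite -(mulr_natr (h * (z * z ^+ k))) -(mulr_natr (h * z ^+ k)).
  by rewrite -(mulr_natr (h ^+ 2 * z ^+ k)); ring.
apply: le_trans (le_normcD _ _) _; rewrite normcM normcMn normcM !normcX.
have hz : normc (z + h) <= normc z + 1.
  by apply: le_trans (le_normcD _ _) _; rewrite lerD2l.
have A := ler_pM (normc_ge0 _) (normc_ge0 _) hz IH.
set rho := normc z + 1 in z1 A *; set e2 := normc h ^+ 2 in A *.
have e20 : 0 <= e2 by rewrite sqr_ge0.
have B : e2 * normc z ^+ k *+ k.+1 <= e2 * (2 * rho) ^+ k.+1 * rho.
  have K1 : k.+1%:R <= 2 ^+ k.+1 :> R by rewrite -natrX ler_nat ltnW// ltn_expl.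
  have K2 : normc z ^+ k <= rho ^+ k.+1 * rho.
    apply: (@le_trans _ _ (rho ^+ k)); first by rewrite lerXn2r ?nnegrE//; rewrite /rho; lra.
    by rewrite -exprSr ler_weXn2l//; lia.
  rewrite -[leLHS]mulr_natr -[leLHS]mulrA -[leRHS]mulrA ler_wpM2l//.
  rewrite exprMn -mulrA [leLHS]mulrC.
  by apply: ler_pM => //; rewrite exprn_ge0.
apply: le_trans (lerD A B) _; rewrite [in leRHS]exprS.
rewrite le_eqVlt; apply/orP; left; apply/eqP; ring.
Qed.

(** Sum [normc_pow_taylor2] over the coefficients. The radius 4 is twice the factor 2 there, so the
    terms decay geometrically with total at most [B * 2]. *)
Lemma normc_taylor2 (p : {poly R}) (B : R) z h : normc h <= 1 ->
  (forall k, `|p`_k| * (4 * (normc z + 1)) ^+ k <= B) ->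
  normc ((complex_poly p).[z + h] - (complex_poly p).[z] - h * (complex_poly p^`()).[z])
    <= normc h ^+ 2 * (B * 2).
Proof.
move=> h1 hB; set rho := normc z + 1 in hB.
have rho0 : 0 <= rho by rewrite addr_ge0 ?normc_ge0.
have -> : complex_poly p^`() = (complex_poly p)^`().
  by rewrite /complex_poly deriv_map.
rewrite !horner_coef size_map_poly.
set n := size p.
(* The derivative is summed over the indices of [p] to combine the sums termwise; at [i = 0] the
   truncated [i.-1] is harmless, the term being a multiple by 0. *)
have -> : \sum_(i < size (complex_poly p)^`()) (complex_poly p)^`()`_i * z ^+ i =
   \sum_(i < n) (complex_poly p)`_i * (z ^+ i.-1 *+ i).
  rewrite -horner_coef -[complex_poly p in LHS]coefK poly_def size_map_poly -/n.
  rewrite raddf_sum horner_sum; apply: eq_bigr => i _.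
  by rewrite -[X in X.[z]]/(deriv _) derivZ derivXn hornerZ hornerMn hornerXn.
rewrite mulr_sumr -!sumrB; apply: le_trans (normc_sum _ _ _) _.
apply: (@le_trans _ _ (\sum_(i < n) normc h ^+ 2 * (`|p`_i| * (2 * rho) ^+ i))).
  apply: ler_sum => -[[|i] ilt] _ /=.
    rewrite mulr0n !mulr0 expr0 mulr1 subrr subrr normc0.
    by rewrite mulr_ge0 ?sqr_ge0// mulr_ge0.
  rewrite [h * _]mulrCA -!mulrBr normcM coef_map normc_real mulrnAr [leRHS]mulrCA.
  by rewrite ler_wpM2l//; exact: normc_pow_taylor2.
rewrite -mulr_sumr ler_wpM2l ?sqr_ge0//.
rewrite -(big_mkord xpredT (fun i => `|p`_i| * (2 * rho) ^+ i)).
have := @sum_geometric_tail_le (fun i => `|p`_i| * (2 * rho) ^+ i) B 0 n.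
rewrite expr0 invr1 mulr1; apply.
  by move=> k; rewrite mulr_ge0// exprn_ge0// mulr_ge0.
move=> k; rewrite -mulrA -exprMn (_ : 2 * rho * 2 = 4 * rho)//; ring.
Qed.

(** The derivatives converge too, to some [G]. The second-order Taylor bound is uniform in [n], so
    it survives in the limit and makes [G] the derivative of [F]. *)
Lemma super_bounded_limit_entire (q : nat -> {poly R}) : super_bounded q ->
  (forall k, cvgn (fun n => (q n)`_k)) ->
  exists2 F : R[i] -> R[i], entire F &
    forall r e : R, 0 < r -> 0 < e ->
    exists N, forall n z, (N <= n)%N -> normc z <= r ->
      normc (F z - (complex_poly (q n)).[z]) <= e.
Proof.
move=> sb cv; have [F hF] := cvg_complex_poly sb cv.
have [G hG] : exists G : R[i] -> R[i], forall r e : R, 0 < r -> 0 < e ->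
    exists N, forall n z, (N <= n)%N -> normc z <= r ->
      normc (G z - (complex_poly (q n)^`()).[z]) <= e.
  apply: cvg_complex_poly; first exact: super_bounded_deriv.
  move=> k; rewrite (_ : (fun n => _) = (fun n => (q n)`_k.+1 *+ k.+1)); last first.
    by apply/funext => n; rewrite coef_deriv.
  by apply: is_cvgMn; exact: cv.
exists F => // z.
have z1 : 0 < 4 * (normc z + 1) by rewrite mulr_gt0// ltr_wpDl ?normc_ge0.
have [B hB] := sb _ z1.
have B0 : 0 <= B by apply: le_trans (hB 0 0); rewrite mulr_ge0// exprn_ge0// ltW.
have key h : normc h <= 1 ->
    normc (F (z + h) - F z - h * G z) <= normc h ^+ 2 * (B * 2).
  move=> h1; apply/ler_addgt0Pr => e e0.
  have r0 : 0 < normc z + 1 by rewrite ltr_wpDl ?normc_ge0.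
  have e30 : 0 < e / 3 by rewrite divr_gt0.
  have [N hN] := hF _ _ r0 e30; have [N' hN'] := hG _ _ r0 e30.
  pose n := maxn N N'.
  have zh : normc (z + h) <= normc z + 1.
    by apply: le_trans (le_normcD _ _) _; rewrite lerD2l.
  have zz : normc z <= normc z + 1 by rewrite lerDl.
  have a1 := hN n _ (leq_maxl _ _) zh; have a2 := hN n _ (leq_maxl _ _) zz.
  have a3 := hN' n _ (leq_maxr _ _) zz.
  have a4 := normc_taylor2 h1 (hB n).
  set x1 := _ - _ in a1; set x2 := _ - _ in a2; set x3 := _ - _ in a3.
  set x4 := _ - _ in a4.
  have -> : F (z + h) - F z - h * G z = x4 + (x1 - x2 - h * x3).
    by rewrite /x1 /x2 /x3 /x4; ring.
  apply: le_trans (le_normcD _ _) _; rewrite lerD//.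
  apply: le_trans (le_normcD _ _) _; rewrite normcN normcM.
  have b1 := le_normcD x1 (- x2); rewrite normcN in b1.
  have b2 : normc h * normc x3 <= normc x3 by rewrite ler_piMl ?normc_ge0.
  lra.
apply/cvg_ex; exists (G z); apply/cvgrPdist_le => /= e e0.
(* Positivity in [R[i]] forces a zero imaginary part. *)
have eR : e = (complex.Re e)%:C.
  by case: e e0 => a b; rewrite ltcE => /andP[/eqP/= ->].
have e'0 : 0 < complex.Re e by move: e0; rewrite ltcE => /andP[].
set e' := complex.Re e in eR e'0.
(* The 1 makes [key] applicable; the other term makes [normc h * (B * 2)] at most [e'], the added 1
   keeping the denominator positive. *)
pose d := Num.min 1 (e' / (B * 2 + 1)).
have d0 : 0 < d by rewrite lt_min ltr01 divr_gt0// ltr_wpDl// mulr_ge0.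
exists d%:C; first by rewrite /= ltcR.
move=> h /=; rewrite sub0r normrN => hd h0.
have nE w : `|w| = (normc w)%:C by case: w.
have {}hd : normc h < d by rewrite nE ltcR in hd.
rewrite eR nE lecR.
have hn0 : 0 < normc h.
  by rewrite lt_neqAle normc_ge0 andbT eq_sym; apply: contra h0 => /eqP/eq0_normc->.
have /andP[hd1 hd2] : (normc h < 1) && (normc h < e' / (B * 2 + 1)) by rewrite -lt_min.
have := key h (ltW hd1).
have -> : G z - h^-1 *: (F (h *: 1 + z) - F z) = - (h^-1 * (F (z + h) - F z - h * G z)).
  rewrite -[h *: 1]/(h * 1) mulr1 [h + z]addrC.
  rewrite -[h^-1 *: _]/(h^-1 * (F (z + h) - F z)); field.
  exact: h0.
rewrite normcN normcM normcV expr2 -mulrA => k1.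
rewrite mulrC ler_pdivrMr//.
apply: le_trans k1 _; rewrite mulrC ler_wpM2r ?(ltW hn0)//.
rewrite ltr_pdivlMr ?ltr_wpDl ?mulr_ge0// in hd2.
have := normc_ge0 h; nra.
Qed.

(** Around each [z] every large enough integer bounds the modulus on the unit ball; compactness
    makes the integer uniform. *)
Lemma compact_normc_bounded (A : set R[i]^o) : compact A ->
  exists2 r : R, 0 < r & forall z, A z -> normc z <= r.
Proof.
move=> /compact_near_coveringP/(_ nat \oo (fun n (z : R[i]) => normc z <= n%:R) _).
case=> [z Az|N _ hN].
  exists ([set w : R[i]^o | `|z - w| < 1],
          [set n | (`|Num.bound (normc z + 1)| <= n)%N]) => /=.
    split; last by exists (`|Num.bound (normc z + 1)|)%N.
    exact: (@nbhsx_ballx _ _ z 1 ltr01).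
  move=> [w n] /= [zw nn].
  have wz : normc (w - z) <= 1.
    rewrite -normcN opprB -lecR.
    by move: zw => /ltW; case: (z) (w) => a b [c d].
  rewrite -[w](subrK z); apply: le_trans (le_normcD _ _) _.
  have h0 : 0 <= normc z + 1 by rewrite addr_ge0 ?normc_ge0.
  have := archi_boundP h0 => h1; apply: le_trans (ltW (lt_le_trans h1 _)); last first.
    by rewrite ler_nat; exact: nn.
  by rewrite addrC lerD2l.
exists N.+1%:R => // z Az; have := hN N.+1 (leqnSn N) z Az => /=; exact.
Qed.

Lemma family_compact_cvg (u : nat -> R[i] -> R[i]) (F : R[i] -> R[i]) :
  (forall r e : R, 0 < r -> 0 < e -> exists N, forall n z, (N <= n)%N ->
     normc z <= r -> normc (F z - u n z) <= e) ->
  {family compact, u @ \oo --> (F : R[i]^o -> R[i]^o)}.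
Proof.
move=> h; apply/(fam_cvgP (U := R[i]^o) (V := R[i]^o)) => A /compact_normc_bounded[r r0 Ar].
move=> P /uniform_nbhs[E [entE EP]].
have [e e0 eE] : exists2 e : R, 0 < e & forall x y : R[i]^o, normc (x - y) <= e -> E (x, y).
  have /= := entE; rewrite -entourage_ballE => -[e /= e0 eE].
  have e'0 : 0 < complex.Re e by move: e0; rewrite ltcE => /andP[].
  exists (complex.Re e / 2); first by rewrite divr_gt0.
  move=> x y xy; apply: eE => /=; rewrite -ball_normE /ball_/=.
  have -> : e = (complex.Re e)%:C.
    by case: e e0 {e'0 xy} => a b; rewrite ltcE => /andP[/eqP/= ->].
  have -> : `|x - y| = (normc (x - y : R[i]))%:C by case: (x) (y) => a b [].
  rewrite ltcR; apply: le_lt_trans xy _.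
  by rewrite ltr_pdivrMr// mulr_natr mulr2n ltrDl.
have [N hN] := h r e r0 e0; exists N => // n /= Nn.
by apply: EP => z Az; apply: eE; apply: hN => //; apply: Ar.
Qed.

End PowerSeriesLimits.

(** * Diagonal subsequences *)

Section DiagonalExtraction.
Variable R : realType.

Lemma ultra_fmap (S T : Type) (f : S -> T) (U : set_system S) :
  UltraFilter U -> UltraFilter (f @ U).
Proof.
move=> UU; split; first exact: fmap_proper_filter.
move=> G GG UG; apply/seteqP; split => // A GA.
have [//|UnA] := in_ultra_setVsetC (f @^-1` A) UU.
have /filter_ex[x [Ax nAx]] : G (A `&` ~` A).
  by apply: filterI => //; exact: UG.
by [].
Qed.

(* The limits are taken along an ultrafilter, which replaces the successive
   extractions of subsequences. *)
Lemma bounded_diagonal_cvg (u : nat -> nat -> R) :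
  (forall k, exists B, forall n, `|u n k| <= B) ->
  exists2 phi : nat -> nat, (forall m, (m <= phi m)%N) &
    forall k, cvgn (fun m => u (phi m) k).
Proof.
move=> bu; have [U [UU ooU]] := ultraFilterLemma eventually_filter.
have lim_k k : exists l : R, (fun n => u n k) @ U --> l.
  have [B hB] := bu k.
  have := @segment_compact R (- B) B; rewrite compact_ultra.
  move=> /(_ _ (ultra_fmap (fun n => u n k) UU)) []; last by move=> l [_ ul]; exists l.
  apply: ooU; exists 0%N => // n _ /=.
  by rewrite in_itv/= -ler_norml.
have [l hl] := choice lim_k.
(* For fixed [m] these are finitely many conditions, each holding on a member of [U]; their
   intersection is in [U], hence nonempty. *)
have ex m : exists n, (m <= n)%N /\ forall k, (k <= m)%N -> `|l k - u n k| <= m.+1%:R^-1.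
  suff : U [set n | (m <= n)%N /\ forall k, (k <= m)%N -> `|l k - u n k| <= m.+1%:R^-1].
    by move=> /filter_ex.
  apply: filterI; first by apply: ooU; exists m.
  suff H j : U [set n | forall k, (k < j)%N -> `|l k - u n k| <= m.+1%:R^-1] by exact: (H m.+1).
  elim: j => [|j IH]; first by apply: filterS filterT => n _ k.
  have /cvgrPdist_le/(_ m.+1%:R^-1)/(_ ltac:(by rewrite invr_gt0)) := hl j.
  apply: filterS2 IH => n /= h1 h2 k.
  by rewrite ltnS leq_eqVlt => /orP[/eqP->|/h1].
have [phi hphi] := choice ex; exists phi => [m|k]; first by case: (hphi m).
apply/cvg_ex; exists (l k); apply/cvgrPdist_le => e e0.
have [N _ hN] : \forall n \near \oo, n.+1%:R^-1 < e by exact: near_infty_natSinv_lt (PosNum e0).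
exists (maxn N k) => // m /=; rewrite geq_max => /andP[Nm km].
apply: le_trans ((hphi m).2 k km) (ltW _); exact: hN.
Qed.

End DiagonalExtraction.

(** * Polynomials that are nearly constant on a non-null set *)

Section Density.
Variable R : realType.
Local Notation mu := (@lebesgue_measure R).
Implicit Types E : set R.

Lemma mu_itvoo (x y : R) : x <= y -> mu `]x, y[%classic = (y - x)%:E.
Proof.
move=> xy; rewrite lebesgue_measure_itv/= lte_fin.
by case: ltgtP xy => // ->; rewrite subrr.
Qed.

Lemma measurable_itvD E (x y : R) : measurable E ->
  measurable (`]x, y[%classic `\` E).
Proof. by move=> mE; exact: measurableD. Qed.

(** Almost every point of [E] is a Lebesgue density point, so one exists in [E]; take a small
    interval centred there. *)
Lemma dense_itv E : measurable E -> (0 < mu E)%E -> forall d : R, 0 < d ->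
  exists x y, x < y /\ (mu (`]x, y[ `\` E) <= (d * (y - x))%:E)%E.
Proof.
move=> mE E0 d d0.
have [x Ex /fine_cvgP[fx cx]] : exists2 x, E x &
    (mu (E `&` ball x r) * (mu (ball x r))^-1)%E @[r --> 0^'+] --> (\1_E x)%:E.
  have [N [mN N0 hN]] := lebesgue_density mE.
  apply: contrapT => H; have : (mu E <= mu N)%E.
    apply: le_measure; rewrite ?inE// => x Ex; apply: hN => /= hx.
    by apply: H; exists x.
  by rewrite N0 leNgt E0.
rewrite indicE mem_set// in cx.
move/cvgrPdist_le: cx => /(_ d d0) cx.
have /filter_ex[r [r0 fr hr]] : \forall r \near (0 : R)^'+, [/\ 0 < r,
    (mu (E `&` ball x r) * (mu (ball x r))^-1)%E \is a fin_num &
    `|1 - fine (mu (E `&` ball x r) * (mu (ball x r))^-1)%E| <= d].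
  near=> r; split; first by near: r; exact: nbhs_right_gt.
    by near: r; exact: fx.
  by near: r; exact: cx.
exists (x - r), (x + r); split; first by lra.
rewrite -ball_itv; have bE : mu (ball x r) = (r *+ 2)%:E by rewrite lebesgue_measure_ball// ltW.
have r20 : r *+ 2 != 0 by rewrite mulrn_eq0/= gt_eqF.
have mb : measurable (ball x r) by rewrite ball_itv; exact: measurable_itv.
have mEb : measurable (E `&` ball x r) by exact: measurableI.
have fEb : mu (E `&` ball x r) \is a fin_num.
  rewrite ge0_fin_numE//; apply: le_lt_trans (_ : mu (ball x r) < +oo)%E.
    by apply: le_measure; rewrite ?inE.
  by rewrite bE ltry.
have -> : mu (ball x r `\` E) = (mu (ball x r) - mu (E `&` ball x r))%E.
  by rewrite [in RHS]setIC measureD//; last by rewrite [ltLHS]bE ltry.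
move: hr; rewrite bE -(fineK fEb) inver (negbTE r20) -EFinM/= -EFinB lee_fin.
set f := fine _ => /ler_normlP[_].
rewrite lerBlDr -lerBlDl ler_pdivlMr ?mulrn_wgt0//; nra.
Unshelve. all: by end_near. Qed.

Lemma meets_itv E (x y : R) : x < y -> (mu (`]x, y[ `\` E) < (y - x)%:E)%E ->
  exists2 t, E t & x < t < y.
Proof.
move=> xy; apply: contra_ltP => H.
rewrite (_ : _ `\` E = `]x, y[%classic) ?mu_itvoo ?(ltW xy)//.
apply/seteqP; split => t /=; first by case.
move=> h; split => // Et; apply: H; exists t => //.
Qed.

Lemma le_mu_itvD E (x y x' y' : R) : measurable E -> x <= x' -> y' <= y ->
  (mu (`]x', y'[ `\` E) <= mu (`]x, y[ `\` E))%E.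
Proof.
move=> mE xx yy; apply: le_measure; rewrite ?inE; try exact: measurable_itvD.
apply: setSD => t /=; rewrite !in_itv/= => /andP[h1 h2].
by rewrite (le_lt_trans xx h1) (lt_le_trans h2 yy).
Qed.

(** Cut the interval into seven equal slots. Less than one slot is missing from [E], so each slot
    meets [E]; taking every other slot leaves a full slot between consecutive points. *)
Lemma four_points E (x y : R) : measurable E -> x < y ->
  (mu (`]x, y[ `\` E) < ((y - x) / 7)%:E)%E ->
  exists t1 t2 t3 t4, [/\ E t1, E t2, E t3 & E t4] /\
    [/\ x < t1, (y - x) / 7 <= t2 - t1, (y - x) / 7 <= t3 - t2,
        (y - x) / 7 <= t4 - t3 & t4 < y].
Proof.
move=> mE xy h.
have slot (i : R) : 0 <= i -> i + 1 <= 7 -> exists2 t, E t &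
    x + (y - x) / 7 * i < t < x + (y - x) / 7 * (i + 1).
  move=> i0 i7; apply: meets_itv; first by nra.
  rewrite [X in X%:E](_ : _ = (y - x) / 7); last by ring.
  apply: le_lt_trans h; apply: le_mu_itvD => //; nra.
have [t1 E1 /andP[a1 b1]] := slot 0 ltac:(lra) ltac:(lra).
have [t2 E2 /andP[a2 b2]] := slot 2 ltac:(lra) ltac:(lra).
have [t3 E3 /andP[a3 b3]] := slot 4 ltac:(lra) ltac:(lra).
have [t4 E4 /andP[a4 b4]] := slot 6 ltac:(lra) ltac:(lra).
exists t1, t2, t3, t4; split; split => //; lra.
Qed.

(** Stated with quotients, the condition is invariant under multiplication by a nonzero constant. *)
Definition flat_on E (p : {poly R}) : Prop :=
  (forall t, E t -> p.[t] != 0) /\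
  forall t u, E t -> E u -> p.[t] / p.[u] <= 1 + 1 / 100.

(** For consecutive zeros, a smaller missing measure would give [four_points] in the gap and
    contradict [gap_not_flat]. Otherwise cut at a zero in between and add, by induction on the
    number of such zeros. *)
Lemma zeros_of_flat E s (a b : R) : measurable E -> flat_on E (root_poly s) ->
  a \in s -> b \in s -> a < b ->
  (((b - a) / 7)%:E <= mu (`]a, b[ `\` E))%E.
Proof.
move=> mE [E0 flat].
have [n] := ubnP (count (fun c => a < c < b) s).
elim: n => // n IH in a b *; rewrite ltnS => cn sa sb ab.
have [/hasP[c sc /andP[ac cb]]|/hasPn noc] := boolP (has (fun c => a < c < b) s).
  have cnt a' b' : a <= a' -> b' <= b -> ~~ (a' < c < b') ->
      (count (fun c => (a' < c < b')%R) s < n)%N.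
    move=> aa bb nc; apply: leq_trans cn.
    have : (count (fun c => (a' < c < b')%R) s + count_mem c s <=
            count (fun c => (a < c < b)%R) s)%N.
      rewrite -count_predUI (@eq_count _ (predI _ _) pred0); last first.
        move=> d /=; apply/negP => /andP[h /eqP dc]; rewrite dc in h.
        by rewrite h in nc.
      rewrite count_pred0 addn0; apply: sub_count => d /= /orP[/andP[h1 h2]|/eqP->].
        by rewrite (le_lt_trans aa h1) (lt_le_trans h2 bb).
      by rewrite ac cb.
    have : (0 < count_mem c s)%N by rewrite -has_count has_pred1.
    lia.
  have h1 := IH a c (cnt a c (lexx _) (ltW cb) ltac:(by rewrite ltxx andbF)) sa sc ac.
  have h2 := IH c b (cnt c b (ltW ac) (lexx _) ltac:(by rewrite ltxx)) sc sb cb.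
  have -> : (b - a) / 7 = (c - a) / 7 + (b - c) / 7 by field.
  rewrite EFinD; apply: le_trans (leeD h1 h2) _.
  rewrite -measureU; try exact: measurable_itvD.
    apply: le_measure; rewrite ?inE; try exact: measurable_itvD.
      by apply: measurableU; exact: measurable_itvD.
    move=> t /= [[h nE]|[h nE]]; split => //; move: h; rewrite !in_itv/= => /andP[u v].
      by rewrite u (lt_trans v cb).
    by rewrite v (lt_trans ac u).
  apply/seteqP; split => // t /= [[+ _] [+ _]]; rewrite !in_itv/= => /andP[_ u] /andP[v _].
  by move: (lt_trans u v); rewrite ltxx.
rewrite leNgt; apply/negP => /(four_points mE ab)[t1 [t2 [t3 [t4]]]].
move=> [[e1 e2 e3 e4] [h1 h2 h3 h4 h5]].
apply: (@gap_not_flat _ s a ((b - a) / 7) t1 t2 t3 t4) => //; try lra.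
- move=> c sc; have := noc c sc; apply: contra => /andP[u v].
  by rewrite (lt_le_trans h1 u) (le_lt_trans v h5).
- exact: flat.
- exact: flat.
Qed.

(** [D] depends on [E] alone: the two quadruples are fixed before [p], and one of them spans an
    interval free of zeros of [p]. *)
Lemma flat_poly_bounded E : measurable E -> (0 < mu E)%E ->
  exists D : R -> R, forall (p : {poly R}) (A : R), only_real_zeros p ->
    flat_on E p -> (forall t, E t -> `|p.[t]| <= A) ->
    forall r (z : R[i]), normc z <= r -> normc (complex_poly p).[z] <= A * D r.
Proof.
move=> mE E0.
(* Anything below 1 / 21 works: [four_points] in an outer third, and [zeros_of_flat] for zeros more
   than [(y - x) / 3] apart, both compare with [(y - x) / 21]. *)
have d0 : 0 < 1 / 48 :> R by rewrite divr_gt0.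
have [x [y [xy hxy]]] := dense_itv mE E0 d0.
have third (x' y' : R) : x <= x' -> y' <= y -> y' - x' = (y - x) / 3 ->
    exists t1 t2 t3 t4, [/\ E t1, E t2, E t3 & E t4] /\
    [/\ x' < t1, t1 < t2, t2 < t3, t3 < t4 & t4 < y'].
  move=> xx yy E3; have xy' : x' < y' by lra.
  have [|t1 [t2 [t3 [t4 [hE [h1 h2 h3 h4 h5]]]]]] := four_points mE xy'.
    apply: le_lt_trans (le_mu_itvD mE xx yy) _; apply: le_lt_trans hxy _.
    by rewrite lte_fin E3; lra.
  by exists t1, t2, t3, t4; split => //; split => //; lra.
have [a1 [a2 [a3 [a4 [[A1 A2 A3 A4] [a01 a12 a23 a34 a45]]]]]] :=
  third x (x + (y - x) / 3) ltac:(lra) ltac:(lra) ltac:(lra).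
have [b1 [b2 [b3 [b4 [[B1 B2 B3 B4] [b01 b12 b23 b34 b45]]]]]] :=
  third (y - (y - x) / 3) y ltac:(lra) ltac:(lra) ltac:(lra).
have [C hC] := sum_inv_bounded a12 a23 a34.
have [C' hC'] := sum_inv_bounded b12 b23 b34.
pose g (t C r : R) := expR ((r + `|t|) * C + (r + `|t|) ^+ 2 / 2 * C).
(* A sum, since which quadruple is free of zeros depends on [p]. *)
exists (fun r => g a2 C r + g b2 C' r) => p A hp [p0 pf] pA r z zr.
have [c [s [c0 pE]]] := real_rooted_split hp; rewrite pE in p0 pf pA *.
have s0 t : E t -> t \notin s.
  move=> /p0; rewrite hornerZ mulf_eq0 negb_or => /andP[_].
  by apply: contra => ts; rewrite -/(root _ t) root_prod_XsubC.
have sf t u : E t -> E u -> (root_poly s).[t] / (root_poly s).[u] <= 1 + 1 / 100.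
  by move=> Et Eu; have := pf t u Et Eu; rewrite !hornerZ -mulf_div divff ?mul1r.
have sflat : flat_on E (root_poly s).
  split => // t /p0; rewrite hornerZ mulf_eq0 negb_or => /andP[] //.
have Ap : 0 <= A by apply: le_trans (pA _ A1).
have gen t C0 : E t -> `|sum_inv s t| <= C0 /\ \sum_(a <- s) (t - a) ^- 2 <= C0 ->
    normc (complex_poly (c *: root_poly s)).[z] <= A * g t C0 r.
  move=> Et [h1 h2]; apply: normc_split_poly_le => //; [exact: s0|exact: pA].
have [/hasP[a sa /andP[u v]]|/hasPn na] := boolP (has (fun a => a1 <= a <= a4) s).
  have [/hasP[b sb /andP[u' v']]|/hasPn nb] := boolP (has (fun b => b1 <= b <= b4) s).
    exfalso; have ab : a < b by lra.
    have := zeros_of_flat mE sflat sa sb ab; rewrite leNgt => /negP; apply.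
    have [xa yb] : x <= a /\ b <= y by split; lra.
    apply: le_lt_trans (le_mu_itvD mE xa yb) _.
    by apply: le_lt_trans hxy _; rewrite lte_fin; lra.
  apply: le_trans (gen b2 C' B2 (hC' _ nb (sf _ _ B2 B1) (sf _ _ B3 B4))) _.
  by rewrite ler_wpM2l// lerDr expR_ge0.
apply: le_trans (gen a2 C A2 (hC _ na (sf _ _ A2 A1) (sf _ _ A3 A4))) _.
by rewrite ler_wpM2l// lerDl expR_ge0.
Qed.

End Density.

(** * Weak-* limits *)

Section WeakStar.
Variable R : realType.
Local Notation T := (lebesgueR R).
Implicit Types A E I : set R.

Lemma measurable_lebesgueR A : measurable A -> measurable (A : set T).
Proof. exact: sub_caratheodory. Qed.

Lemma measurable_poly_lebesgueR A (p : {poly R}) : measurable (A : set T) ->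
  measurable_fun (A : set T) (fun x : T => p.[x]).
Proof.
move=> mA _ B mB; apply: measurableI => //.
rewrite -[X in measurable X]setTI; apply: measurable_lebesgueR.
exact: measurable_poly.
Qed.

Lemma negligible_lebesgueR A : measurable A ->
  lebesgue_measure A = 0%E -> (leb R).-negligible A.
Proof. by move=> mA A0; exists A; split => //; exact: measurable_lebesgueR. Qed.

(** Testing against indicators and using dominated convergence, [f] and [h] have the same integral
    over every measurable subset of [A]. *)
Lemma weak_star_pointwise I A (u : nat -> R -> R) (f h : R -> R) (M : R) :
  measurable (I : set T) -> (leb R I < +oo)%E ->
  measurable_fun (I : set T) (f : T -> R) -> [bounded f x | x in I] ->
  (forall n, measurable_fun (I : set T) (u n : T -> R)) ->
  (forall n x, I x -> `|u n x| <= M) -> weak_star_cvg I u f ->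
  measurable (A : set T) -> A `<=` I ->
  (forall x, A x -> u n x @[n --> \oo] --> h x) ->
  {ae leb R, forall x : R, A x -> f x = h x}.
Proof.
move=> mI fI mf bf mu bu wu mA AI uh.
have uA n : measurable_fun (A : set T) (u n : T -> R) by exact: measurable_funS (mu n).
have mh : measurable_fun (A : set T) (h : T -> R) by exact: measurable_fun_cvg uA uh.
have finS E : measurable (E : set T) -> E `<=` I -> (leb R E < +oo)%E.
  by move=> mE EI; apply: le_lt_trans fI; apply: le_measure; rewrite ?inE.
have int_f E : measurable (E : set T) -> E `<=` I ->
    (leb R).-integrable E (EFin \o (f : T -> R)).
  move=> mE EI; apply: measurable_bounded_integrable => //; first exact: finS.
    exact: measurable_funS mf.
  by have [B [Br hB]] := bf; exists B; split => // y By x Ex; apply: (hB y By); exact: EI.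
have : ae_eq (leb R) (A : set T) (EFin \o (f : T -> R)) (EFin \o (h : T -> R)).
  apply: integral_ae_eq => //; [exact: int_f|exact/measurable_EFinP|].
  move=> E EA mE; have EI : E `<=` I by apply: subset_trans EA AI.
  have gi : (leb R).-integrable (I : set T) (EFin \o (\1_E : T -> R)).
    apply: measurable_bounded_integrable => //.
    exists 1; split; first exact: num_real.
    move=> y y1 x _ /=; rewrite indicE.
    by case: (x \in E); rewrite ?normr1 ?normr0 ltW// (lt_trans ltr01).
  have := wu _ gi.
  have reduce (g : R -> R) :
      \int[leb R]_(x in I) (g x * \1_E x) = \int[leb R]_(x in E) g x.
    by rewrite -[in RHS](setIidr EI) Rintegral_mkcondr patch_indic.
  rewrite reduce (_ : (fun n => _) = (fun n => \int[leb R]_(x in E) u n x)); last first.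
    by apply/funext => n; rewrite reduce.
  move=> cv.
  have [_ _ D] : [/\ (leb R).-integrable (E : set T) (EFin \o (h : T -> R)),
      [sequence (\int[leb R]_(x in E)
                  (fun n x => `|(u n x)%:E - (h x)%:E|) n x)%E]_n
      x @[x --> \oo] --> 0%E
     & [sequence (\int[leb R]_(x in E) (u n x)%:E)%E]_n n @[n --> \oo] -->
     (\int[leb R]_(x in E) (h x)%:E)%E].
    apply: (@dominated_convergence _ _ _ (leb R) (E : set T) mE _ _ (EFin \o cst M)).
    - move=> n; apply/measurable_EFinP; exact: measurable_funS (uA n).
    - apply/measurable_EFinP; exact: measurable_funS mh.
    - by apply: aeW => x Ex; apply: cvg_EFin; [exact: nearW|apply: uh; exact: EA].
    - apply: measurable_bounded_integrable => //; first exact: finS.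
      exists `|M|; split; first exact: num_real.
      by move=> y yM x _; exact: ltW.
    - by apply: aeW => x n Ex; rewrite lee_fin; apply: bu; exact: EI.
  have : ((\int[leb R]_(x in E) u n x)%:E @[n --> \oo]) --> (\int[leb R]_(x in E) (f x)%:E)%E.
    rewrite -[X in _ --> X]fineK; last by apply: integrable_fin_num => //; exact: int_f.
    by apply: cvg_EFin => //; exact: nearW.
  rewrite (_ : (fun n => _) = (fun n => (\int[leb R]_(x in E) (u n x)%:E)%E)); last first.
    apply/funext => n; rewrite fineK//; apply: integrable_fin_num => //.
    apply: measurable_bounded_integrable => //; first exact: finS.
      exact: measurable_funS (uA n).
    exists M; split; first exact: num_real.
    by move=> y yM x Ex; apply: le_trans (ltW yM); apply: bu; exact: EI.
  by move=> /cvg_lim <- //; move/cvg_lim: D => <-.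
by apply: filterS => x /= H Ax; have [] := H Ax.
Qed.

Lemma weak_star_poly_pointwise A (p : nat -> {poly R}) (f h : R -> R) (M : R) :
  let I := `[-1, 1]%classic in
  measurable_fun (I : set T) (f : T -> R) -> [bounded f x | x in I] ->
  (forall n x, I x -> `|(p n).[x]| <= M) ->
  weak_star_cvg I (fun n x => (p n).[x]) f -> measurable A -> A `<=` I ->
  (forall x, A x -> (p n).[x] @[n --> \oo] --> h x) ->
  {ae leb R, forall x : R, A x -> f x = h x}.
Proof.
move=> I mf bf bp wp mA AI ph.
have mI : measurable (I : set T).
  by apply: measurable_lebesgueR; exact: measurable_itv.
have fI : (leb R I < +oo)%E.
  rewrite -[X in (X < _)%E]/(lebesgue_measure _) lebesgue_measure_itv/=.
  by case: ifP => _; rewrite -?EFinB ltry.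
apply: (weak_star_pointwise mI fI mf bf _ bp wp _ AI ph).
  by move=> n; exact: measurable_poly_lebesgueR.
exact: measurable_lebesgueR.
Qed.

End WeakStar.

(** * Laguerre-Polya limits and almost everywhere divergence *)

Section Main.
Variable R : realType.

(** Dividing by [c] treats both signs at once; the lower bound 1 also excludes [c = 0] and zeros of
    [p n] in [E], division by 0 giving 0. *)
Lemma LaguerrePolya_of_flat (f : R -> R) (p : nat -> {poly R}) (M : R)
    (E : set R) (c : R) N :
  [bounded f x | x in (`[-1, 1]%classic : set R)] ->
  measurable_fun (`[-1, 1]%classic : set (lebesgueR R)) (f : lebesgueR R -> R) ->
  (forall n, only_real_zeros (p n)) ->
  (forall n x, x \in `[-1, 1] -> `|(p n).[x]| <= M) ->
  weak_star_cvg `[-1, 1]%classic (fun n x => (p n).[x]) f ->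
  measurable E -> (0 < lebesgue_measure E)%E ->
  (forall n x, (N <= n)%N -> E x -> 1 < (p n).[x] / c < 1 + 1 / 100) ->
  exists F : R[i] -> R[i], LaguerrePolya F /\
    {ae leb R, forall x : R, `[-1, 1]%classic x -> (f x)%:C = F x%:C}.
Proof.
move=> bf mf rp bp wp mE E0 hE.
have [D hD] := flat_poly_bounded mE E0.
(* Dropping the first [N] terms makes the estimates on [E] hold for every index. *)
pose p' n := p (N + n)%N.
have hE' n x : E x -> 1 < (p' n).[x] / c < 1 + 1 / 100.
  by move=> Ex; apply: hE; rewrite ?leq_addr.
have c0 n x : E x -> c != 0 /\ (p' n).[x] != 0.
  move=> /(hE' n)/andP[h _]; split; apply: contraTneq h => ->.
    by rewrite invr0 mulr0 ltr10.
  by rewrite mul0r ltr10.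
have flat n : flat_on E (p' n).
  split => [t /(c0 n)[]//|t u Et Eu].
  have [cn0 pu0] := c0 n u Eu.
  have /andP[h1 h2] := hE' n t Et; have /andP[h3 h4] := hE' n u Eu.
  have -> : (p' n).[t] / (p' n).[u] = ((p' n).[t] / c) / ((p' n).[u] / c).
    by field; rewrite cn0 pu0.
  by rewrite ler_pdivrMr; nra.
have bA n t : E t -> `|(p' n).[t]| <= `|c| * (1 + 1 / 100).
  move=> Et; have /andP[h1 h2] := hE' n t Et; have [cn0 _] := c0 n t Et.
  rewrite -[(p' n).[t]](divfK cn0) normrM mulrC ler_wpM2l// ger0_norm; lra.
have sb : super_bounded p'.
  move=> r r0; exists (`|c| * (1 + 1 / 100) * D r) => n k.
  have := @coef_le_circle R (complex_poly (p' n)) r _ r0 _ k.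
  rewrite coef_map normc_real; apply.
  move=> z zr; apply: (hD (p' n) _ _ (flat n) (bA n)) => //; first exact: rp.
  by rewrite zr.
have [phi phige phicv] : exists2 phi : nat -> nat, (forall m, (m <= phi m)%N) &
    forall k, cvgn (fun m => (p' (phi m))`_k).
  apply: (@bounded_diagonal_cvg R (fun n k => (p' n)`_k)) => k.
  have [B hB] := sb 1 ltr01; exists B => n.
  by have := hB n k; rewrite expr1n mulr1.
pose q m := p' (phi m).
have sbq : super_bounded q.
  by move=> r r0; have [B hB] := sb r r0; exists B => n; exact: hB.
have [F entF qF] := super_bounded_limit_entire sbq phicv.
exists F; split.
  split=> //; exists q; split; first by move=> n; exact: rp.
  exact: family_compact_cvg.
have Fx (x e : R) : 0 < e -> exists m, forall n, (m <= n)%N ->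
    normc (F x%:C - (q n).[x]%:C) <= e.
  move=> e0; have x1 : 0 < `|x| + 1 by rewrite ltr_wpDl.
  have [m hm] := qF _ _ x1 e0; exists m => n mn.
  have := hm n x%:C mn; rewrite /complex_poly horner_map; apply.
  by rewrite normc_real lerDl.
(* The approximating polynomials take real values on the real line. *)
have FIm x : complex.Im (F x%:C) = 0.
  apply/eqP; rewrite -normr_eq0 eq_le normr_ge0 andbT; apply/ler_addgt0Pr => e e0.
  rewrite add0r; have [m hm] := Fx x e e0; apply: le_trans (hm m (leqnn m)).
  have := Im_le_normc (F x%:C - (q m).[x]%:C).
  by case: (F x%:C) => a b /=; rewrite subr0.
have : {ae leb R, forall x : R, `[-1, 1]%classic x -> f x = complex.Re (F x%:C)}.
  apply: (weak_star_poly_pointwise (p := q) (M := M) mf bf).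
  - by move=> n x Ix; exact: bp.
  (* The subsequence inherits the weak-* limit because [N + phi m] tends to infinity. *)
  - move=> g ig; apply: (cvg_comp (fun m => (N + phi m)%N)
      (fun n => \int[leb R]_(x in `[-1, 1]) ((p n).[x] * g x))); last exact: wp.
    move=> P [m _ hm]; exists m => // n /= mn; apply: hm => /=.
    by apply: leq_trans (leq_trans mn (phige n)) (leq_addl _ _).
  - exact: measurable_itv.
  - by [].
  - move=> x _; apply/cvgrPdist_le => e e0; have [m hm] := Fx x e e0.
    exists m => // n /= mn; apply: le_trans (hm n mn).
    have := Re_le_normc (F x%:C - (q n).[x]%:C).
    by case: (F x%:C) => a b.
apply: negligibleS => x /=; apply: contra_not => H Ix; rewrite H//.
by have := FIm x; case: (F x%:C) => a b /= ->.
Qed.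

End Main.

Theorem mainTheorem3 (R : realType) (I : set R) (f : R -> R)
    (p : nat -> {poly R}) :
  I = `[-1, 1]%classic ->
  [bounded f x | x in I] ->
  measurable_fun (I : set (lebesgueR R)) (f : lebesgueR R -> R) ->
  ~ (exists F : R[i] -> R[i], LaguerrePolya F /\
       {ae leb R, forall x : R, I x -> (f x)%:C = F x%:C}) ->
  (forall n, only_real_zeros (p n)) ->
  (exists M : R, forall n x, I x -> `|(p n).[x]| <= M) ->
  weak_star_cvg I (fun n x => (p n).[x]) f ->
  {ae leb R, forall x : R, I x -> f x != 0 -> ~ cvgn (fun n => (p n).[x])}.
Proof.
move=> -> bf mf nLP rp [M bM] wp.
(* A nonzero limit [l] satisfies [1 < l / q < 1 + 1 / 100] for some rational [q]. *)
pose E (qN : rat * nat) : set R := `[-1, 1]%classic `&`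
  \bigcap_(n in [set n | (qN.2 <= n)%N])
    (fun x : R => (p n).[x]) @^-1` [set y | 1 < y / ratr qN.1 < 1 + 1 / 100].
have mE qN : measurable (E qN).
  apply: measurableI; first exact: measurable_itv.
  apply: bigcap_measurable; first by exists qN.2 => /=.
  move=> n _; rewrite -[X in measurable X]setTI.
  have mp : measurable_fun setT (fun x : R => (p n).[x] / ratr qN.1).
    by apply: measurable_funM => //; exact: measurable_poly.
  have := mp measurableT `]1, 1 + 1 / 100[%classic (measurable_itv _).
  by congr measurable; congr setI; apply/seteqP; split => x /=; rewrite in_itv.
(* On a non-null [E qN] the polynomials would be nearly constant, and [f] would agree almost
   everywhere with a Laguerre-Polya function. *)
have nE qN : (leb R).-negligible (E qN).
  apply: negligible_lebesgueR => //; apply/eqP; rewrite eq_le measure_ge0 andbT leNgt.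
  apply/negP => E0; apply: nLP.
  apply: (@LaguerrePolya_of_flat R f p M (E qN) (ratr qN.1) qN.2) => //.
  by move=> n x nN [_ /(_ n nN)].
(* A zero limit cannot be normalized by a rational; on [Z] the weak-* limit itself gives [f = 0]
   almost everywhere. *)
pose Z : set R := `[-1, 1]%classic `&`
  [set x | (p n).[x] @[n --> \oo] --> (0 : R)].
have mZ : measurable Z.
  rewrite (_ : Z = `[-1, 1]%classic `&`
    \bigcap_k \bigcup_N \bigcap_(n in [set n | (N <= n)%N])
      (fun x : R => (p n).[x]) @^-1` [set y | - k.+1%:R^-1 <= y <= k.+1%:R^-1]).
    apply: measurableI; first exact: measurable_itv.
    apply: bigcapT_measurable => k; apply: bigcupT_measurable => N.
    apply: bigcap_measurable; first by exists N => /=.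
    move=> n _; rewrite -[X in measurable X]setTI.
    have := measurable_poly (p n) measurableT (measurable_itv `[- k.+1%:R^-1, k.+1%:R^-1]).
    by congr measurable; congr setI; apply/seteqP; split => x /=; rewrite in_itv.
  rewrite /Z; congr setI; apply/seteqP; split => x /=.
    move=> /cvgrPdist_le h k _; have [|N _ hN] := h k.+1%:R^-1; first by rewrite invr_gt0.
    by exists N => // n /= /hN/=; rewrite sub0r normrN ler_norml.
  move=> h; apply/cvgrPdist_le => e e0.
  have [k _ hk] : \forall k \near \oo, k.+1%:R^-1 < e by exact: near_infty_natSinv_lt (PosNum e0).
  have [N _ hN] := h k Logic.I; exists N => // n /= Nn; rewrite sub0r normrN.
  apply: le_trans (ltW (hk k (leqnn k))); rewrite ler_norml; exact: hN.
have fZ : {ae leb R, forall x : R, Z x -> f x = 0}.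
  apply: (weak_star_poly_pointwise (p := p) (M := M) mf bf bM wp mZ).
    by move=> x [].
  by move=> x [].
(* The pairs are enumerated by [unpickle], with the empty set for numbers that code no pair. *)
have nU : (leb R).-negligible (\bigcup_k oapp E set0 (unpickle k)).
  apply: negligible_bigcup => k; case: unpickle => [qN|] /=; first exact: nE.
  exact: negligible_set0.
apply: negligibleS (negligibleU fZ nU) => x /= /not_implyP[Ix /not_implyP[fx /contrapT cx]].
pose l := lim ((p n).[x] @[n --> \oo]).
have [l0|l0] := eqVneq l 0.
  left => /= H.
  by move: fx; rewrite H ?eqxx//; split => //=; rewrite -l0; exact: cx.
right.
have [q qP] : exists q : rat, 1 < l / ratr q < 1 + 1 / 100.
  (* The condition says that [q] lies strictly between [l * (100 / 101)] and [l], whose order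
     depends on the sign of [l]. *)
  have [lneg|lpos] : l < 0 \/ 0 < l by apply/orP; rewrite -neq_lt.
    have [q] : exists q : rat, ratr q \in `]l, (l * (100 / 101))[ by apply: rat_in_itvoo; lra.
    rewrite in_itv/= => /andP[h1 h2]; exists q.
    rewrite -mulrNN -invrN ltr_pdivlMr ?ltr_pdivrMr; lra.
  have [q] : exists q : rat, ratr q \in `](l * (100 / 101)), l[ by apply: rat_in_itvoo; lra.
  rewrite in_itv/= => /andP[h1 h2]; exists q.
  rewrite ltr_pdivlMr ?ltr_pdivrMr; lra.
have [N _ hN] : \forall n \near \oo, 1 < (p n).[x] / ratr q < 1 + 1 / 100.
  have cl : (p n).[x] / ratr q @[n --> \oo] --> l / ratr q by apply: cvgMl; exact: cx.
  case/andP: qP => q1 q2; near=> n; apply/andP; split; near: n.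
    by apply: cvgr_gt cl _ q1.
  by apply: cvgr_lt cl _ q2.
exists (pickle (q, N)); first exact: Logic.I.
by rewrite pickleK; split => [|n Nn]; [exact: Ix|exact: hN].
Unshelve. all: by end_near. Qed.
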